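(* Let $G$ be a finite, non-trivial abelian group of exponent $m$, and suppose that $B_1,\ldots,B_k$ are generating subsets of $G$. If $k>2m\ln\log_2|G|$, then the multiset union $B_1\cup\dots\cup B_k$ is an additive basis of $G$; equivalently, $B_1^\ast+\dots+B_k^\ast=G$. That is, for every $g\in G$ there exist subsets $A_1\subseteq B_1,\ldots,A_k\subseteq B_k$ such that $g=\sum_{i=1}^k\sum_{a\in A_i}a$.
   Context: A multiset $B=\{b_1,\ldots,b_n\}$ of elements of an abelian group $G$ is an additive basis of $G$ if for every $g\in G$ there is an index set $I\subseteq\{1,\ldots,n\}$ with $g=\sum_{i\in I}b_i$. For a subset $B$ of an abelian group, $B^\ast=\{\sum_{a\in A}a : A\subseteq B,\ |A|<\infty\}$ is its subset sum set (the empty sum being $0$), and $B_1+\dots+B_k=\{b_1+\dots+b_k: b_i\in B_i\}$ is the sumset. *)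

(* Defs.v *)
From mathcomp Require Import all_boot all_order all_fingroup all_algebra all_solvable.
From mathcomp Require Import finmap multiset.
From mathcomp Require Import reals exp.

Set Implicit Arguments.
Unset Strict Implicit.
Unset Printing Implicit Defensive.

Import GRing.Theory Num.Theory.
Local Open Scope ring_scope.

Definition log2 (R : realType) (x : R) : R := ln x / ln 2.

(* The elements of [B], listed with multiplicity by the coercion to [seq], play
   the role of b_1, ..., b_n; [size B] is the number of elements of [B] counted
   with multiplicity. *)
Definition additive_basis (G : zmodType) (B : {mset G}%mset) : Prop :=
  forall g : G, exists I : {set 'I_(size B)}, g = \sum_(i in I) B`_i.

(* In a multiset union the multiplicities add up: this is [msetD], whereas
   [msetU] takes their maximum. *)
Definition multiset_union (T : finType) (k : nat) (B : 'I_k -> {set T}) :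
    {mset T}%mset :=
  \big[@msetD T/@mset0 T]_(i < k) seq_mset (enum (B i)).

(* Every subset of [B] is finite here, so no finiteness condition is needed. *)
Definition subset_sums (G : finZmodType) (B : {set G}) : {set G} :=
  [set \sum_(a in A) a | A : {set G} in powerset B].

Definition sumset (G : finZmodType) (k : nat) (S : 'I_k -> {set G}) : {set G} :=
  [set \sum_(i < k) b i | b : {ffun 'I_k -> G} in family S].

(* Main.v *)
(* Write C_i for the subset sum set of B_i. Every element of G is a combination
   of elements of B_i with coefficients less than m, so the m-fold sumset of
   C_i is G. By Pluennecke's inequality, in the form due to Petridis, this gives
   |A + C_i|^m / |A|^m >= |G| / |A| for every nonempty A, i.e. adding C_i
   multiplies ln (|G| / |A|) by at most 1 - 1/m. Split the k sets into two
   halves, with sums A and A'. The bound on k and the AM-GM inequality then yield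
   |A| + |A'| > |G|, which forces A + A' = G. *)
Require Import Defs.
From mathcomp Require Import all_boot all_order all_fingroup all_algebra all_solvable.
From mathcomp Require Import finmap multiset.
From mathcomp Require Import reals sequences exp.
From mathcomp Require Import zify ring lra.

Set Implicit Arguments.
Unset Strict Implicit.
Unset Printing Implicit Defensive.

Import Order.TTheory GRing.Theory Num.Theory.

(* The hypothesis says that [A] minimises #|Z * C| / #|Z| over its nonempty
   subsets [Z]. *)
Lemma petridis (gT : finGroupType) (A C : {set gT}) :
  (forall Z : {set gT}, Z \subset A ->
    #|A * C|%g * #|Z| <= #|Z * C|%g * #|A|) ->
  forall D : {set gT}, #|D * A * C|%g * #|A| <= #|A * C|%g * #|D * A|%g.
Proof.
move=> minA D; have [n] := ubnP #|D|; elim: n D => // n IHn D.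
have [-> _|[d dD] leDn] := set_0Vmem D; first by rewrite !mul0g !cards0.
rewrite -(setD1K dD) setUC; move: leDn; rewrite (cardsD1 d) dD add1n ltnS.
move: (D :\ d) => E /IHn{IHn D dD}.
(* [d] is the element put back into the rest [E] of [D]. [Z] collects the a in [A] with d a C
   already inside E A C, so that adding [d] enlarges E A C by at most |A C| - |Z C| elements;
   minimality bounds |Z C| from below. *)
pose Z := [set a in A | d *: (a *: C) \subset E * A * C]%g.
have sZA : Z \subset A by apply/subsetP=> a; rewrite inE => /andP[].
have := minA Z sZA.
have leAC : #|(E :|: [set d]) * A * C|%g + #|Z * C|%g
    <= #|E * A * C|%g + #|A * C|%g.
  have <- : ((E * A * C) :|: d *: (A * C) = (E :|: [set d]) * A * C)%g.
    by rewrite !mulUg !mulgA.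
  rewrite -(card_lcoset (A * C)%g d) -(cardsUI (E * A * C)%g) leq_add2l.
  rewrite -(card_lcoset (Z * C)%g d).
  rewrite subset_leq_card // subsetI [X in _ && X]mulgS ?mulSg // andbT.
  apply/subsetP=> x; rewrite mem_lcoset => /mulsgP[z c zZ cC xE].
  move: zZ; rewrite inE => /andP[_ /subsetP]; apply.
  by rewrite !mem_lcoset xE mulKg.
(* If d a lies in E A, then d a C lies in E A C, so a is in [Z]. *)
have leA : #|E * A|%g + #|A| <= #|(E :|: [set d]) * A|%g + #|Z|.
  rewrite mulUg -(card_lcoset A d) -cardsUI leq_add2l -(card_lcoset Z d).
  apply/subset_leq_card/subsetP=> x.
  rewrite in_setI !mem_lcoset inE => /andP[xEA ->] /=.
  by rewrite -lcosetM mulKVg mulSg ?sub1set.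
nia.
Qed.

(** Iterates [petridis] with [D] a power of [C]. Commutation turns C^h A into A C^h, so each further
    factor [C] costs at most the ratio |A C| / |A|. *)
Lemma petridis_expg (gT : finGroupType) (A C : {set gT}) (h : nat) :
  (forall Z : {set gT}, Z \subset A ->
    #|A * C|%g * #|Z| <= #|Z * C|%g * #|A|) ->
  commute C A ->
  #|A * C ^+ h|%g * #|A| ^ h <= #|A * C|%g ^ h * #|A|.
Proof.
move=> minA cCA; elim: h => [|h IHh].
  by rewrite expg0 mulg1 !expn0 muln1 mul1n.
have cAX : (A * C ^+ h = C ^+ h * A)%g := commuteX h (commute_sym cCA).
have := petridis minA (C ^+ h)%g.
rewrite -cAX -mulgA -expgSr !expnS => leX.
rewrite mulnA (leq_trans (leq_mul leX (leqnn _))) // -!mulnA.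
by rewrite leq_mul2l IHh orbT.
Qed.

(** [petridis_expg] is applied to a subset [D] of [A] minimising |D C| / |D|, for which D C^m is the
    whole group. Then |D C| / |D| <= |A C| / |A| and |D| <= |A| carry the bound over to [A]. *)
Lemma card_mulg_growth (gT : finGroupType) (A C : {set gT}) (m : nat) :
  abelian [set: gT] -> A != set0 -> (C ^+ m = [set: gT])%g ->
  #|gT| * #|A| ^ m <= #|A * C|%g ^ m * #|A|.
Proof.
move=> abG A0 Cm.
pose F (Z : {set gT}) : rat := (#|Z * C|%g%:R / #|Z|%:R)%R.
pose P (Z : {set gT}) := (Z \subset A) && (Z != set0).
have PA : P A by rewrite /P subxx.
case: (@Order.TotalTheory.arg_minP _ _ _ A P F PA) => D /andP[sDA D0] minD.
have gt0D : 0 < #|D| by rewrite card_gt0.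
have minF (Z : {set gT}) :
    Z \subset A -> #|D * C|%g * #|Z| <= #|Z * C|%g * #|D|.
  move=> sZA; have [->|Z0] := eqVneq Z set0; first by rewrite cards0 muln0.
  have := minD Z; rewrite /P sZA Z0 => /(_ isT).
  rewrite /F ler_pdivrMr ?ltr0n // mulrAC ler_pdivlMr ?ltr0n ?card_gt0 //.
  by rewrite -!natrM ler_nat.
have cCD : commute C D.
  by apply/centC/(subset_trans (subsetT _))/(subset_trans abG)/centS/subsetT.
have leD := petridis_expg m
  (fun Z sZD => minF Z (subset_trans sZD sDA)) cCD.
have DT : (D * [set: gT] = setT)%g.
  have [x xD] := set0Pn _ D0; apply/setP=> y; rewrite inE.
  by apply/mulsgP; exists x (x^-1 * y)%g; rewrite ?inE ?mulKVg.
rewrite Cm DT cardsT in leD.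
have leX : (#|D * C|%g * #|A|) ^ m <= (#|A * C|%g * #|D|) ^ m.
  by case: (m) => // n; rewrite leq_exp2r // minF.
suff leA : #|gT| * #|A| ^ m <= #|A * C|%g ^ m * #|D|.
  by rewrite (leq_trans leA) // leq_mul2l subset_leq_card ?orbT.
rewrite -(@leq_pmul2r (#|D| ^ m)) ?expn_gt0 ?gt0D // mulnAC.
rewrite (leq_trans (leq_mul leD (leqnn _))) // mulnAC -expnMn.
by rewrite (leq_trans (leq_mul leX (leqnn _))) // expnMn mulnAC.
Qed.

Local Open Scope ring_scope.

(** Pigeonhole: [A] and g C^-1 are too large to be disjoint, and a common element x gives g = x
    (x^-1 g). *)
Lemma mulg_setT (gT : finGroupType) (A C : {set gT}) :
  (#|gT| < #|A| + #|C|)%N -> (A * C = [set: gT])%g.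
Proof.
move=> ltAC; apply/setP=> g; rewrite inE.
have : (A :&: (g *: C^-1)%g) != set0.
  apply: contraTneq ltAC => AC0; rewrite -leqNgt.
  rewrite -(card_invg C) -(card_lcoset C^-1%g g).
  by rewrite -cardsUI AC0 cards0 addn0 max_card.
case/set0Pn=> x /setIP[xA]; rewrite mem_lcoset inE invMg invgK => xC.
by apply/mulsgP; exists x (x^-1 * g)%g; rewrite ?mulKVg.
Qed.

(** Passes to set products in the additive group of [G], where the growth lemmas apply. *)
Lemma sumsetE (G : finZmodType) (k : nat) (S : 'I_k -> {set G}) :
  sumset S = (\prod_(i < k) S i)%g.
Proof.
apply/setP=> g; apply/imsetP/prodsgP => [[b /familyP bS ->]|[c cS ->]].
  by exists b.
exists [ffun i => c i]; first by apply/familyP=> i; rewrite ffunE cS.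
by apply: eq_bigr => i _; rewrite ffunE.
Qed.

Lemma expg_subset_sums (G : finZmodType) (B : {set G}) :
  <<B>>%g = [set: G] -> (subset_sums B ^+ exponent [set: G] = [set: G])%g.
Proof.
move=> genB; set m := exponent _; have m_gt0 : (0 < m)%N by apply: exponent_gt0.
apply/setP=> x; rewrite !inE.
have <- : (\prod_(j < m) subset_sums B = subset_sums B ^+ m)%g.
  by elim: (m) => [|n IHn]; rewrite ?big_ord0 ?expg0 // big_ord_recr IHn expgSr.
have /gen_prodgP[n [c cB xE]] : x \in <<B>>%g by rewrite genB inE.
(* [f b] counts the occurrences of the generator b in a word for [x], modulo [m]. The j-th of the
   [m] summands takes every b with j < f b, so b is used exactly [f b] times in total. *)
pose f b := (#|[set i | c i == b]| %% m)%N.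
apply/prodsgP.
exists (fun j : 'I_m => \sum_(b in [set b in B | (j < f b)%N]) b).
  move=> j _; apply/imsetP; exists [set b in B | (j < f b)%N] => //.
  by rewrite powersetE; apply/subsetP=> b; rewrite inE => /andP[].
have -> : x = \sum_(i < n) c i by [].
rewrite (partition_big c (mem B)) //=.
transitivity (\sum_(b in B) b *+ f b).
  apply: eq_bigr => b bB; rewrite (eq_bigr (fun=> b)); last by move=> i /eqP.
  rewrite sumr_const -cardsE {1}(divn_eq #|_| m) mulrnDr mulnC mulrnA.
  have -> : b *+ m = 0 by apply/(exponentP (dvdnn m))/in_setT.
  by rewrite mul0rn add0r.
change (\sum_(b in B) b *+ f b =
  \sum_(j < m) \sum_(b in [set b in B | (j < f b)%N]) b).
rewrite (exchange_big_dep (mem B)) => [|j b _] /=; last first.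
  by rewrite inE => /andP[].
apply: eq_bigr => b bB.
rewrite (eq_bigl (fun j : 'I_m => (j < f b)%N)) => [|j]; last by rewrite inE bB.
have le_fm : (f b <= m)%N by rewrite ltnW ?ltn_pmod.
by rewrite (big_ord_narrow le_fm) sumr_const card_ord.
Qed.

(** The induction starts from the empty product, a single point with deficit ln |G|. Nonemptiness is
    carried along because the growth bound and the logarithms rely on it. *)
Lemma ln_card_prodg (R : realType) (gT : finGroupType) (I : Type) (r : seq I)
    (C : I -> {set gT}) (m : nat) :
  abelian [set: gT] -> (0 < m)%N -> (forall i, (C i ^+ m = [set: gT])%g) ->
  (0 < #|\prod_(i <- r) C i|%g)%N /\
  ln #|gT|%:R - ln #|\prod_(i <- r) C i|%g%:R
    <= (1 - m%:R^-1) ^+ size r * ln (#|gT|%:R : R).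
Proof.
move=> abG m_gt0 Cm; elim/last_ind: r => [|r i [IH0 IH]].
  by rewrite big_nil cards1 ln1 expr0 mul1r subr0.
rewrite big_rcons size_rcons /= exprS.
move: (\prod_(j <- r) C j)%g IH0 IH => A A_gt0 leA.
have gt0N : (0 < #|gT|)%N by rewrite (leq_trans A_gt0) // max_card.
have A0 : A != set0 by rewrite -card_gt0.
have growth := card_mulg_growth abG A0 (Cm i).
have gt0AC : (0 < #|A * C i|%g)%N.
  have : (0 < #|A * C i|%g ^ m * #|A|)%N.
    by rewrite (leq_trans _ growth) // muln_gt0 expn_gt0 gt0N A_gt0.
  by rewrite muln_gt0 expn_gt0 => /andP[/orP[//|/eqP m0]]; rewrite m0 in m_gt0.
split=> //; move: growth; rewrite -(ler_nat R) !natrM !natrX.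
rewrite -ler_ln ?posrE ?mulr_gt0 ?exprn_gt0 ?ltr0n //.
rewrite !lnM ?posrE ?exprn_gt0 ?ltr0n // !lnXn ?ltr0n //.
rewrite -!(mulr_natl (ln _)) => growth.
rewrite -mulrA; set y := _ ^+ _ * _ in leA *.
have m0 : 0 < m%:R :> R by rewrite ltr0n.
have m1 : 1 <= m%:R :> R by rewrite ler1n.
apply: (@le_trans _ _ ((1 - m%:R^-1) * (ln #|gT|%:R - ln #|A|%:R))).
  rewrite -(ler_pM2l m0) [leRHS]mulrA [_ * (1 - _)]mulrBr divff ?gt_eqF //.
  lra.
by rewrite ler_wpM2l // subr_ge0 invf_le1.
Qed.

(** Rests on 1 + t <= exp t. For odd [k] the halves differ by one, and (1 + q) / 2 = 1 - 1/(2m)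
    supplies the missing half step: for either parity the mean is at most exp (-k/(2m)). *)
Lemma half_contraction_lt1 (R : realType) (m k : nat) (x : R) :
  (0 < m)%N -> 0 < x -> 2 * m%:R * ln x < k%:R ->
  ((1 - m%:R^-1) ^+ k./2 + (1 - m%:R^-1) ^+ (k - k./2)) / 2 * x < 1.
Proof.
move=> m_gt0 x_gt0 ltk; set q := 1 - m%:R^-1.
have m0 : 0 < m%:R :> R by rewrite ltr0n.
have q0 : 0 <= q by rewrite subr_ge0 invf_le1 // ler1n.
have kE : (k - k./2 = k./2 + odd k)%N by lia.
have kR : k%:R = (odd k)%:R + k./2%:R * 2 :> R.
  by rewrite -natrM -natrD; congr _%:R; lia.
have -> : (q ^+ k./2 + q ^+ (k - k./2)) / 2 =
    q ^+ k./2 * ((1 + q ^+ odd k) / 2).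
  by rewrite kE exprD; ring.
have leq_half : (1 + q ^+ odd k) / 2 <= expR (- (odd k)%:R / (2 * m%:R)).
  case: (odd k) => /=.
    apply: le_trans (expR_ge1Dx _); rewrite expr1 /q invfM; lra.
  by rewrite expr0 oppr0 mul0r expR0; lra.
have leq_pow : q ^+ k./2 <= expR (- k./2%:R / m%:R).
  rewrite mulNr mulrC -mulNr expRM_natr lerXn2r ?nnegrE ?expR_ge0 //.
  exact: expR_ge1Dx.
apply: (@le_lt_trans _ _ (expR (- k%:R / (2 * m%:R)) * x)).
  rewrite ler_pM2r // kR.
  have -> : - ((odd k)%:R + k./2%:R * 2) / (2 * m%:R)
    = - k./2%:R / m%:R + - (odd k)%:R / (2 * m%:R) :> R.
    by field; rewrite gt_eqF.
  rewrite expRD ler_pM ?exprn_ge0 //.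
  by rewrite divr_ge0 // addr_ge0 // exprn_ge0.
rewrite -[X in _ * X](lnK x_gt0) -expRD -[ltRHS]expR0 ltr_expR.
rewrite mulNr addrC subr_lt0 ltr_pdivlMr ?mulr_gt0 //.
by rewrite mulrC.
Qed.

Lemma sumset_subset_sums (R : realType) (G : finZmodType) (k : nat)
    (B : 'I_k -> {set G}) :
  (1 < #|G|)%N ->
  (forall i : 'I_k, <<B i>>%g = [set: G]) ->
  2 * (exponent [set: G])%:R * ln (log2 (#|G|%:R : R)) < k%:R ->
  sumset (fun i => subset_sums (B i)) = [set: G].
Proof.
move=> G1 genB; have := exponent_gt0 [set: G].
move eq_m: (exponent _) => m m_gt0 ltk.
rewrite sumsetE.
have Cm i : (subset_sums (B i) ^+ m = [set: G])%g.
  by rewrite -eq_m expg_subset_sums.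
have abG : abelian [set: G] by apply: FinRing.zmod_abelian.
rewrite -(cat_take_drop k./2 (index_enum _)) big_cat; apply: mulg_setT.
have [gt0A] := ln_card_prodg R (take k./2 (index_enum 'I_k)) abG m_gt0 Cm.
have [gt0C] := ln_card_prodg R (drop k./2 (index_enum 'I_k)) abG m_gt0 Cm.
have sz : size (index_enum 'I_k) = k.
  by rewrite [index_enum _]unlock -enumT size_enum_ord.
rewrite size_drop size_takel sz; last by lia.
move: gt0A gt0C; set a := #|_|; set c := #|_| => gt0a gt0c lnc lna.
have ln2_gt0 : 0 < ln 2 :> R by rewrite ln_gt0 // ltr1n.
have lnN_gt0 : 0 < ln #|G|%:R :> R by rewrite ln_gt0 // ltr1n.
(* With x = log2 |G|, the mean of the two bounds on the logarithmic deficits is below ln 2. *)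
have := half_contraction_lt1 m_gt0 (divr_gt0 lnN_gt0 ln2_gt0) ltk.
rewrite mulrA ltr_pdivrMr // mul1r => contr.
rewrite ltnNge; apply/negP => le_acN.
move: G1 le_acN lnc lna lnN_gt0 contr; set N := #|G|.
move=> G1 le_acN lnc lna lnN_gt0 contr.
(* By AM-GM, a + c <= N would make the two deficits add up to at least 2 ln 2. *)
have : (a * c * 4 <= N * N)%N.
  by rewrite mulnC (leq_trans (nat_AGM2 _ _)) // leq_sqr.
rewrite -(ler_nat R) !natrM.
have gt0N : (0 < N)%N by apply: ltnW.
rewrite -ler_ln ?posrE ?mulr_gt0 ?ltr0n // !lnM ?posrE ?mulr_gt0 ?ltr0n //.
have -> : ln 4 = ln 2 + ln 2 :> R by rewrite -lnM ?posrE // -natrM.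
lra.
Qed.

(** [t] is a permutation of a subsequence of the listing of [M]; the mask of that subsequence is the
    index set. *)
Lemma sub_mset_sum (G : zmodType) (M : {mset G}%mset) (t : seq G) :
  (forall x, count_mem x t <= M x)%N ->
  exists I : {set 'I_(size M)}, \sum_(x <- t) x = \sum_(i in I) M`_i.
Proof.
move=> let_M.
have /count_subseqP[_ /subseqP[b _ ->] tb] x :
    (count_mem x t <= count_mem x M)%N.
  by rewrite -(mset_seqE M) seq_mset_id.
exists [set i | nth false b (val i)].
rewrite (perm_big (mask b M)) //.
rewrite big_mask; apply: eq_big => [i|i _]; first by rewrite inE andbT.
by rewrite (tnth_nth 0).
Qed.

(** An element of several [A i] must be used once for each of them. Multiplicities add up in the
    union, so the concatenation of the [A i] fits into it. *)
Lemma additive_basis_multiset_union (G : finZmodType) (k : nat)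
    (B : 'I_k -> {set G}) :
  (forall g : G, exists A : 'I_k -> {set G},
     (forall i : 'I_k, A i \subset B i) /\
     g = \sum_(i < k) \sum_(a in A i) a) ->
  additive_basis (multiset_union B).
Proof.
move=> repr g; have [A [sAB ->]] := repr g.
pose t := flatten [seq enum (A i) | i <- index_enum 'I_k].
have [x|I tI] := @sub_mset_sum _ (multiset_union B) t; last first.
  exists I; rewrite -[RHS]tI /t big_flatten big_map; apply: eq_bigr => i _.
  by rewrite big_enum.
rewrite /t /multiset_union.
elim: (index_enum _) => [|i s IHs] /=; first by rewrite big_nil.
rewrite big_cons msetE2 count_cat leq_add //.
rewrite mset_seqE !count_uniq_mem ?enum_uniq //.
rewrite !mem_enum; case: (boolP (x \in A i)) => // /(subsetP (sAB i)) -> //.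
Qed.

(* [<<_>>] and [exponent] refer to the additive group of [G]. *)
Theorem theorem1 (R : realType) (G : finZmodType) (m k : nat)
    (B : 'I_k -> {set G}) :
  (1 < #|G|)%N ->
  m = exponent [set: G] ->
  (forall i : 'I_k, <<B i>>%g = [set: G]) ->
  2 * m%:R * ln (log2 (#|G|%:R : R)) < k%:R ->
  [/\ additive_basis (multiset_union B),
      sumset (fun i => subset_sums (B i)) = [set: G] &
      forall g : G, exists A : 'I_k -> {set G},
        (forall i : 'I_k, A i \subset B i) /\
        g = \sum_(i < k) \sum_(a in A i) a].
Proof.
move=> G1 -> genB ltk.
have sumT := sumset_subset_sums G1 genB ltk.
have repr (g : G) : exists A : 'I_k -> {set G},
    (forall i, A i \subset B i) /\ g = \sum_(i < k) \sum_(a in A i) a.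
  have : g \in sumset (fun i => subset_sums (B i)) by rewrite sumT inE.
  case/imsetP=> b /familyP bB ->.
  have /fin_all_exists2[A sAB bE] i :
      exists2 A : {set G}, A \subset B i & b i = \sum_(a in A) a.
    by have /imsetP[A] := bB i; rewrite powersetE => sAB ->; exists A.
  by exists A; split=> //; apply: eq_bigr.
by split=> //; apply: additive_basis_multiset_union.
Qed.
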